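(* The family $\mathcal{T}_{\mathcal{CE}}$ of all rooted trees (with at least two vertices) together with all simple-confluent epimorphisms between them is a projective Fraïssé family.
   Context: A graph is a pair $(V,E)$ with $E\subseteq V^2$ reflexive and symmetric. A tree is a finite graph in which any two distinct vertices are joined by a unique sequence of pairwise distinct vertices with consecutive ones adjacent. A rooted tree is a tree $T$ with distinguished root $r_T$; $x\le y$ iff the path from $r_T$ to $y$ contains $x$; an edge is written $\langle a,b\rangle$ with $a<b$. Epimorphisms between rooted trees are maps on vertices sending edges to edges, surjective on vertices and edges, sending root to root and order-preserving. A set of vertices is connected if it is not a union of two nonempty disjoint sets with no edge between them. An epimorphism $f$ is confluent if for every connected $Q$ in the target, each component $K$ of $f^{-1}(Q)$ satisfies $f(K)=Q$; light if no two distinct vertices with the same image are adjacent. A splitting edge map $f\colon S\to T$: $V(S)=V(T)\cup\{x\}$ with $x$ new, and for some edge $\langle a,b\rangle\in E(T)$, $E(S)$ is obtained from $E(T)$ by removing $\langle a,b\rangle$ and adding $\langle a,x\rangle,\langle x,b\rangle$; $f$ is the identity on $V(T)$ and sends $x$ to $a$ or to $b$. A simple-monotone epimorphism is a composition of splitting edge maps. A simple-confluent epimorphism is a finite composition $f_1\circ\dots\circ f_n$ where each $f_i$ is light confluent or simple-monotone. A projective Fraïssé family is a class of finite (rooted) graphs with a fixed class of epimorphisms such that: there are countably many isomorphism types; the epimorphisms are closed under composition and contain identities; (JPP) any two members are both images of some member under fixed epimorphisms; (AP) for fixed $f\colon B\to A$, $g\colon C\to A$ there are $D$ and fixed $f_0\colon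 D\to B$, $g_0\colon D\to C$ with $f\circ f_0=g\circ g_0$. *)

(* Defs.v *)
From HB Require Import structures.
From mathcomp Require Import all_boot.

Set Implicit Arguments.
Unset Strict Implicit.
Unset Printing Implicit Defensive.

Definition upath (V : finType) (adj : rel V) (u v : V) (p : seq V) : bool :=
  [&& path adj u p, last u p == v & uniq (u :: p)].

Definition is_tree (V : finType) (adj : rel V) : Prop :=
  forall u v : V, u != v ->
    (exists p, upath adj u v p) /\
    (forall p q, upath adj u v p -> upath adj u v q -> p = q).

Record rtree := RTree {
  rt_V : finType;
  rt_adj : rel rt_V;
  rt_root : rt_V;
  rt_refl : reflexive rt_adj;
  rt_sym : symmetric rt_adj;
  rt_tree : is_tree rt_adj
}.

Definition tle (T : rtree) (x y : rt_V T) : Prop :=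
  exists p, upath (@rt_adj T) (rt_root T) y p /\ x \in rt_root T :: p.

Definition epi (S T : rtree) (f : rt_V S -> rt_V T) : Prop :=
  [/\ (forall x y, rt_adj x y -> rt_adj (f x) (f y)),
      (forall v : rt_V T, exists x, f x = v),
      (forall u v : rt_V T, rt_adj u v ->
          exists x y, [/\ rt_adj x y, f x = u & f y = v]),
      f (rt_root S) = rt_root T &
      (forall x y, tle x y -> tle (f x) (f y))].

Definition connected_set (T : rtree) (Q : {set rt_V T}) : Prop :=
  forall A B : {set rt_V T}, A :|: B = Q -> A :&: B = set0 ->
    (forall a b, a \in A -> b \in B -> ~~ rt_adj a b) ->
    A = set0 \/ B = set0.

Definition component (T : rtree) (P K : {set rt_V T}) : Prop :=
  [/\ K \subset P, K != set0, connected_set K &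
      forall L : {set rt_V T}, K \subset L -> L \subset P ->
        connected_set L -> L = K].

Definition confluent (S T : rtree) (f : rt_V S -> rt_V T) : Prop :=
  forall Q : {set rt_V T}, connected_set Q ->
    forall K : {set rt_V S}, component (f @^-1: Q) K -> f @: K = Q.

Definition light (S T : rtree) (f : rt_V S -> rt_V T) : Prop :=
  forall x y, x != y -> f x = f y -> ~~ rt_adj x y.

Definition light_confluent (S T : rtree) (f : rt_V S -> rt_V T) : Prop :=
  [/\ epi f, light f & confluent f].

(* Splitting edge map f : S -> T. V(T) is identified with V(S) \ {x} via f
   (f is the identity on V(T)); the root of S is the root of T. *)
Definition splitting_edge_map (S T : rtree) (f : rt_V S -> rt_V T) : Prop :=
  exists (x : rt_V S) (a b : rt_V T),
    [/\ rt_adj a b, a != b & tle a b] /\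
    x != rt_root S /\
    f (rt_root S) = rt_root T /\
    (forall u v, u != x -> v != x -> f u = f v -> u = v) /\
    (forall w : rt_V T, exists2 u, u != x & f u = w) /\
    (forall u v, u != x -> v != x ->
        rt_adj u v = rt_adj (f u) (f v) &&
          ~~ (((f u == a) && (f v == b)) || ((f u == b) && (f v == a)))) /\
    (forall v, v != x -> rt_adj x v = (f v == a) || (f v == b)) /\
    ((f x == a) || (f x == b)).

(* Simple-confluent epimorphisms: finite compositions of light confluent
   epimorphisms and splitting edge maps (simple-monotone maps being
   compositions of splitting edge maps). *)
Inductive simple_confluent : forall S T : rtree, (rt_V S -> rt_V T) -> Prop :=
| sc_light S T (f : rt_V S -> rt_V T) : light_confluent f -> simple_confluent f
| sc_split S T (f : rt_V S -> rt_V T) : splitting_edge_map f -> simple_confluent f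
| sc_comp S U T (f : rt_V U -> rt_V T) (g : rt_V S -> rt_V U) (h : rt_V S -> rt_V T) :
    simple_confluent f -> simple_confluent g -> (forall x, h x = f (g x)) ->
    simple_confluent h.

Definition rt_iso (S T : rtree) : Prop :=
  exists f : rt_V S -> rt_V T,
    [/\ bijective f, (forall x y, rt_adj x y = rt_adj (f x) (f y)) &
        f (rt_root S) = rt_root T].

Definition proj_fraisse_family (F : rtree -> Prop)
    (M : forall S T : rtree, (rt_V S -> rt_V T) -> Prop) : Prop :=
  [/\
      (exists e : nat -> rtree, forall T, F T -> exists n, rt_iso (e n) T),
      (forall S T f, F S -> F T -> @M S T f -> epi f),
      (forall S U T (f : rt_V U -> rt_V T) (g : rt_V S -> rt_V U),
          F S -> F U -> F T -> M U T f -> M S U g -> M S T (fun x => f (g x))) /\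
      (forall T, F T -> M T T (fun x => x)),
      (forall A B, F A -> F B ->
          exists C (f : rt_V C -> rt_V A) (g : rt_V C -> rt_V B),
            [/\ F C, M C A f & M C B g]) &
      (forall A B C (f : rt_V B -> rt_V A) (g : rt_V C -> rt_V A),
          F A -> F B -> F C -> M B A f -> M C A g ->
          exists D (f0 : rt_V D -> rt_V B) (g0 : rt_V D -> rt_V C),
            [/\ F D, M D B f0, M D C g0 & forall x, f (f0 x) = g (g0 x)])].

(* Main.v *)
(** A rooted tree is determined by its parent map.  In these terms a light
    confluent epimorphism is a map that commutes with parents, sends non-root
    vertices to non-root vertices and lifts children.  Two light maps are
    amalgamated by their fibre product; a light map l : B -> A and a splitting of
    an edge of A by splitting all the preimages of that edge in B; two splittings
    of A by performing both (once, if they split the same edge in the same way).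
    In each case the opposite side of the square is of the same kind as, or a
    composition of maps of the same kind as, the given side, so that squares can
    be tiled.  For joint projection, every nontrivial tree maps onto the single
    edge: at a deepest leaf, either fold it onto a sibling, which is also a leaf,
    or contract its parent, of which it is the only child; then amalgamate over
    the edge. *)

Require Import Defs.
From mathcomp Require Import all_boot zify.
From Stdlib Require Import ClassicalEpsilon.

Set Implicit Arguments.
Unset Strict Implicit.
Unset Printing Implicit Defensive.

(** * Parent maps *)

Section ParentFunction.
Variables (V : finType) (p : V -> V) (r : V) (m : V -> nat).
Hypotheses (p_root : p r = r) (p_lt : forall x, x != r -> m (p x) < m x).
Implicit Types u v x y z : V.

(** The arguments follow the tree order: [x] is met when [p] is iterated from [y]. *)
Definition anc x y := fconnect p y x.
Definition padj x y := [|| x == y, p x == y | p y == x].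

Lemma padj_refl : reflexive padj.
Proof. by move=> x; rewrite /padj eqxx. Qed.

Lemma padj_sym : symmetric padj.
Proof. by move=> x y; rewrite /padj eq_sym [(p x == y) || _]orbC. Qed.

Lemma ancP x y : reflect (exists n, x = iter n p y) (anc x y).
Proof.
apply: (iffP idP) => [h|[n ->]]; last exact: fconnect_iter.
by exists (findex p y x); rewrite iter_findex.
Qed.

Lemma anc_refl x : anc x x.
Proof. exact: connect0. Qed.

Lemma anc_par x y : anc x (p y) -> anc x y.
Proof. exact/connect_trans/fconnect1. Qed.

Lemma anc_step x y : anc x y -> x = y \/ anc x (p y).
Proof.
case/ancP => -[|n] ->; [by left|right].
by rewrite iterSr; apply: fconnect_iter.
Qed.

Lemma anc_leq x y : anc x y -> m x <= m y.
Proof.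
case/ancP => n ->; elim: n => //= n; apply: leq_trans.
by case: (eqVneq (iter n p y) r) => [->|/p_lt/ltnW //]; rewrite p_root.
Qed.

Lemma anc_root y : anc r y.
Proof.
have [n] := ubnP (m y); elim: n y => // n IH y h.
case: (eqVneq y r) => [->|/p_lt h']; first exact: anc_refl.
by apply/anc_par/IH; lia.
Qed.

(** The descendants of [x] form a set whose only outgoing edge is the one from [x] to [p x]. The
    next two lemmas turn this into statements on paths. *)
Lemma anc_exit x y z : anc x y -> padj y z -> ~~ anc x z -> y = x /\ z = p x.
Proof.
move=> h /or3P[]/eqP e nz; first by rewrite -e h in nz.
  by case: (anc_step h) => [->|]; [|rewrite e (negPf nz)].
by rewrite -e in h; rewrite (anc_par h) in nz.
Qed.

Lemma path_inside x y s : anc x y -> path padj y s -> p x \notin s ->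
  anc x (last y s).
Proof.
elim: s y => //= z s IH y h /andP[yz hs]; rewrite inE negb_or => /andP[n1 n2].
apply: IH => //; apply: contraNT n1 => /(anc_exit h yz)[_ ->].
by rewrite eqxx.
Qed.

Lemma path_outside x y s : ~~ anc x y -> path padj y s -> x \notin s ->
  ~~ anc x (last y s).
Proof.
elim: s y => //= z s IH y h /andP[yz hs]; rewrite inE negb_or => /andP[n1 n2].
apply: IH => //; apply: contra n1 => hz.
by rewrite padj_sym in yz; case: (anc_exit hz yz h) => ->.
Qed.

Lemma anc_chain x y v : anc x v -> anc y v -> anc x y \/ anc y x.
Proof.
case/ancP => i -> /ancP[j ->].
case: (leqP i j) => [/subnK <-|/ltnW/subnK <-]; rewrite iterD; [right|left];
  exact: fconnect_iter.
Qed.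

Lemma anc_parN x : x != r -> ~~ anc x (p x).
Proof. by move/p_lt => h; apply/negP => /anc_leq; lia. Qed.

Lemma siblings_anc x y : x != r -> p x = p y -> anc x y -> x = y.
Proof.
move=> nx e /anc_step[//|]; rewrite -e => h.
by have := anc_parN nx; rewrite h.
Qed.

(** If both paths first go to [p u], there is nothing to prove. Otherwise one starts with a child
    [a] of [u] and, never returning to [u], ends among the descendants of [a]. The other cannot
    start with [p u], since it would have to pass through [u] again to reach [v]. If it starts with
    a child of [u], this child and [a] have the common descendant [v], so these siblings
    coincide. *)
Lemma first_step_uniq u v x y s t :
  path padj u (x :: s) -> path padj u (y :: t) -> uniq (u :: x :: s) ->
  uniq (u :: y :: t) -> last x s = v -> last y t = v -> x = y.
Proof.
have down (a b w : V) (t1 t2 : seq V) : u != a -> p a = u -> path padj a t1 -> u \notin t1 ->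
    last a t1 = w -> u != b -> padj u b -> path padj b t2 -> u \notin t2 ->
    last b t2 = w -> a = b.
  move=> na pa pt1 n1 l1 nb; rewrite /padj (negPf nb) /= => ub pt2 n2 l2.
  have nar : a != r by apply: contra na => /eqP ea; rewrite -pa ea p_root.
  have aw : anc a w by rewrite -l1; apply: path_inside (anc_refl a) _ _ => //; rewrite pa.
  case/orP: ub => /eqP pb.
    have nu : u != r by apply: contra nb => /eqP eu; rewrite -pb eu p_root.
    have := path_outside (x := u) (y := b) (s := t2).
    rewrite -{1}pb anc_parN // l2 => /(_ isT pt2 n2); rewrite /anc.
    by rewrite (connect_trans aw) // -[X in fconnect _ _ X]pa fconnect1.
  have nbr : b != r by apply: contra nb => /eqP ea; rewrite -pb ea p_root.
  have bw : anc b w by rewrite -l2; apply: path_inside (anc_refl b) _ _ => //; rewrite pb.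
  case: (anc_chain aw bw) => [/siblings_anc -> //|/siblings_anc -> //]; by rewrite pa pb.
move=> /= /andP[ux ps] /andP[uy pt].
rewrite !inE !negb_or => /andP[/andP[nx ns] _] /andP[/andP[ny nt] _] ls lt.
move: (ux) (uy); rewrite /padj (negPf nx) (negPf ny) /=.
case/orP => [/eqP ex|/eqP ex]; last by move=> _; apply: (down x y v s t).
case/orP => [/eqP <- //|/eqP ey]; by apply/esym; apply: (down y x v t s).
Qed.

Lemma padj_tree : is_tree padj.
Proof.
move=> u v _; split=> [|s t].
  have conn w : connect padj r w.
    have /connectP[s hs ->] := anc_root w.
    rewrite (sym_connect_sym padj_sym).
    apply/connectP; exists s => //; apply: sub_path hs => a b /= /eqP <-.
    by rewrite /padj eqxx orbT.
  have : connect padj u v.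
    by apply: connect_trans (conn v); rewrite (sym_connect_sym padj_sym).
  case/connectP => s hs ->; case/shortenP: hs => s' h1 h2 _.
  by exists s'; rewrite /upath h1 h2 eqxx.
elim: s t u => [|x s IH] [|y t] u //; rewrite /upath.
- by move=> /and3P[_ /eqP <- _] /and3P[_ /eqP /= e /andP[]]; rewrite -{1}e mem_last.
- move=> /and3P[_ /eqP e /andP[ns _]] /and3P[_ /eqP e' _].
  by move: e e' => /= e e'; rewrite e' -e mem_last in ns.
move=> /and3P[h1 /eqP h2 h3] /and3P[h4 /eqP h5 h6].
have e := first_step_uniq h1 h4 h3 h6 h2 h5; subst y; congr cons.
move: h1 h2 h3 h4 h5 h6 => /= /andP[_ a1] a2 /andP[_ a3] /andP[_ b1] b2 /andP[_ b3].
by apply: (IH _ x); rewrite /upath ?a1 ?a2 ?b1 ?b2 ?eqxx //= ?a3 ?b3.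
Qed.

Definition parent_tree := @RTree V padj r padj_refl padj_sym padj_tree.
End ParentFunction.

(** * The parent map of a given rooted tree *)

Section Parent.
Variable T : rtree.
Implicit Types u v x y : rt_V T.
Notation root := (rt_root T).
Notation adj := (@rt_adj T).

Lemma root_path_ex v : exists p, upath adj root v p.
Proof.
case: (eqVneq root v) => [<-|/(@rt_tree T) [] //].
by exists [::]; rewrite /upath /= eqxx.
Qed.

Lemma root_path_uniq v p q : upath adj root v p -> upath adj root v q -> p = q.
Proof.
case: (eqVneq root v) => [<-|/(@rt_tree T) [_]]; last exact.
have nil r : upath adj root root r -> r = [::].
  case: r => // a r /and3P[_ /eqP /= e /andP[]].
  by rewrite -{1}e mem_last.
by move=> /nil -> /nil ->.
Qed.

Definition root_path v := xchoose (root_path_ex v).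
Definition ht v := size (root_path v).
(** The vertex just before [v] on its path from the root; since the path of the root is empty, the
    default of [last] makes the root its own parent. *)
Definition par v := last root (take (ht v).-1 (root_path v)).

Lemma root_pathP v : upath adj root v (root_path v).
Proof. exact: xchooseP. Qed.

Lemma root_path_root : root_path root = [::].
Proof. by apply: root_path_uniq (root_pathP _) _; rewrite /upath /= eqxx. Qed.

Lemma ht_root : ht root = 0.
Proof. by rewrite /ht root_path_root. Qed.

Lemma par_root : par root = root.
Proof. by rewrite /par root_path_root. Qed.

Lemma root_path_rcons p v : upath adj root v (rcons p v) ->
  root_path v = rcons p v /\ par v = last root p.
Proof.
move=> h; have e := root_path_uniq (root_pathP v) h; split=> //.
by rewrite /par /ht e size_rcons /= -cats1 take_size_cat.
Qed.

Lemma upath_belast v p : upath adj root v (rcons p v) ->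
  upath adj root (last root p) p /\ adj (last root p) v.
Proof.
rewrite /upath rcons_path -rcons_cons rcons_uniq eqxx /=.
by case/and3P => /andP[-> ->] _ /andP[_ ->].
Qed.

Lemma root_path_par v : v != root ->
  root_path v = rcons (root_path (par v)) v /\ adj (par v) v.
Proof.
move=> nv; have := root_pathP v.
case: (lastP (root_path v)) => [/and3P[_ /eqP e _]|p z h].
  by rewrite -e eqxx in nv.
have e : z = v by case/and3P: (h) => _ /eqP; rewrite last_rcons.
move: h; rewrite {}e => h; have [_ ->] := root_path_rcons h.
have [hp ha] := upath_belast h.
by rewrite (root_path_uniq (root_pathP _) hp).
Qed.

Lemma ht_par v : v != root -> ht v = (ht (par v)).+1.
Proof. by case/root_path_par => e _; rewrite {1}/ht e size_rcons. Qed.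

Lemma ht_par_lt v : v != root -> ht (par v) < ht v.
Proof. by move/ht_par ->. Qed.

Lemma par_neq v : v != root -> par v != v.
Proof. by move/ht_par => h; apply/eqP => e; rewrite e in h; lia. Qed.

Lemma adj_par v : adj (par v) v.
Proof.
case: (eqVneq v root) => [->|/root_path_par[] //].
by rewrite par_root rt_refl.
Qed.

(** Given an edge between [u] and [v]: if [v] is off the root path of [u], appending [v] to that
    path gives the root path of [v], so [par v = u]. If [v] is on it, cutting the path at [v] and
    appending [u] gives the root path of [u], so [par u = v]. *)
Lemma rt_adjE : adj =2 padj par.
Proof.
move=> u v; apply/idP/or3P; last first.
  case=> /eqP <-; [exact: rt_refl|by rewrite rt_sym adj_par|exact: adj_par].
move=> uv; case: (eqVneq u v) => [|nuv]; first by constructor.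
have [vu|vu] := boolP (v \in root :: root_path u); last first.
  apply: Or33; suff /root_path_rcons[_ ->] : upath adj root v (rcons (root_path u) v).
    by case/and3P: (root_pathP u).
  case/and3P: (root_pathP u) => h1 /eqP h2 h3.
  by rewrite /upath rcons_path h1 h2 uv last_rcons eqxx -rcons_cons rcons_uniq vu.
apply: Or32.
case/and3P: (root_pathP u) => h1 /eqP h2 h3.
case/splitPl: vu h1 h2 h3 => p1 p2 e; rewrite cat_path e last_cat e => /andP[h1 h2] h3.
rewrite -cat_cons cat_uniq => /and3P[h4 h5 _].
suff /root_path_rcons[_ ->] : upath adj root u (rcons p1 u) by rewrite e.
rewrite /upath rcons_path h1 e rt_sym uv last_rcons eqxx -rcons_cons rcons_uniq h4 !andbT.
apply: contra h5 => h5; apply/hasP; exists u => //.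
case: p2 h2 h3 => [_ /= e'|a p2 _ <- /=]; first by rewrite e' eqxx in nuv.
exact: mem_last.
Qed.

Lemma tleP x y : tle x y <-> anc par x y.
Proof.
have tleE : tle x y <-> x \in root :: root_path y.
  split=> [[p [hp]]|h]; last by exists (root_path y); split=> //; apply: root_pathP.
  by rewrite (root_path_uniq hp (root_pathP y)).
rewrite {}tleE; have [n] := ubnP (ht y); elim: n y => // n IH y h.
case: (eqVneq y root) => [->|ny].
  rewrite root_path_root inE; split=> [/eqP ->|]; first exact: anc_refl.
  by move/(anc_leq par_root ht_par_lt); case: (eqVneq x root) => // /ht_par ->; rewrite ht_root.
have [-> _] := root_path_par ny.
rewrite -rcons_cons mem_rcons in_cons; split.
  case/orP => [/eqP ->|]; first exact: anc_refl.
  by move/IH => h'; apply/anc_par/h'; rewrite -ltnS -ht_par.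
by case/anc_step => [->|/IH ->]; rewrite ?eqxx ?orbT // -ltnS -ht_par.
Qed.
End Parent.

(** Serves to recover the parent map of a tree built from a given one. Since [x] and [p x] are
    adjacent, the only harmful case is [par (p x) = x]; by induction on [m] it would make [x] the
    [p]-parent of [p x], against the decrease of [m]. *)
Lemma par_unique (T : rtree) (p : rt_V T -> rt_V T) (m : rt_V T -> nat) :
  p (rt_root T) = rt_root T ->
  (forall x, x != rt_root T -> m (p x) < m x) ->
  @rt_adj T =2 padj p -> @par T =1 p.
Proof.
move=> pr pm hadj x.
have [n] := ubnP (m x); elim: n x => // n IH x h.
case: (eqVneq x (rt_root T)) => [->|nx]; first by rewrite par_root pr.
have hx := pm _ nx.
have: rt_adj x (p x) by rewrite hadj /padj eqxx orbT.
rewrite rt_adjE => /or3P[/eqP e|/eqP //|/eqP e]; first by rewrite -e ltnn in hx.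
have ep : par (p x) = p (p x) by apply: IH; lia.
case: (eqVneq (p x) (rt_root T)) => [epx|/pm]; last by rewrite -ep e; lia.
by move: nx; rewrite -e epx par_root eqxx.
Qed.

(** * Light confluent maps *)

Definition light_par (S T : rtree) (f : rt_V S -> rt_V T) : Prop :=
  [/\ f (rt_root S) = rt_root T,
      forall x, x != rt_root S -> f x != rt_root T,
      forall x, f (par x) = par (f x) &
      forall x c, c != rt_root T -> par c = f x ->
        exists2 y, par y = x & f y = c].

(* [f] forgets the vertex [x] subdividing the edge from [par x] to [c]. *)
Record splits (S T : rtree) (f : rt_V S -> rt_V T) (x c : rt_V S) : Prop := Splits {
  splits_new : x != rt_root S;
  splits_child : par c = x;
  splits_only_child : forall v, par v = x -> v = c;
  splits_root : f (rt_root S) = rt_root T;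
  splits_inj : forall u v, u != x -> v != x -> f u = f v -> u = v;
  splits_surj : forall w, exists2 u, u != x & f u = w;
  splits_par : forall v, v != x -> v != c -> f (par v) = par (f v);
  splits_edge : f (par x) = par (f c);
  splits_image : f x = f c \/ f x = f (par x) }.

Definition tree_iso (S T : rtree) (f : rt_V S -> rt_V T) : Prop :=
  [/\ bijective f, f (rt_root S) = rt_root T & forall x, f (par x) = par (f x)].

(** * Connected sets, and edges oriented by the order *)

Section Connected.
Variable T : rtree.
Implicit Types (x y : rt_V T) (K : {set rt_V T}).

Lemma connected_star K x : x \in K -> (forall z, z \in K -> rt_adj x z) ->
  connected_set K.
Proof.
move=> xK adjK.
have aux A B : A :|: B = K -> A :&: B = set0 ->
    (forall a b, a \in A -> b \in B -> ~~ rt_adj a b) -> x \in A -> B = set0.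
  move=> AB _ h xA; apply/setP => b; rewrite in_set0; apply/negP => bB.
  by have := h _ _ xA bB; rewrite adjK // -AB inE bB orbT.
move=> A B AB ABI h; move: (xK); rewrite -AB inE => /orP[xA|xB]; first by right; apply: aux h xA.
left; apply: (aux B A); rewrite 1?setUC 1?setIC //.
by move=> b a hb ha; rewrite rt_sym h.
Qed.

(** In a separation of [y |: K] the neighbours [x] and [y] lie on the same side. Deleting [y] from
    that side leaves a separation of [K] with [x] on it, so the other side is empty. *)
Lemma connected_add K x y : connected_set K -> x \in K -> rt_adj x y ->
  connected_set (y |: K).
Proof.
move=> cK xK xy; case: (boolP (y \in K)) => [yK|yK].
  by have -> : y |: K = K by apply/setUidPr; rewrite sub1set.
have aux A B : A :|: B = y |: K -> A :&: B = set0 ->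
    (forall a b, a \in A -> b \in B -> ~~ rt_adj a b) -> y \in A -> B = set0.
  move=> AB ABI h yA.
  have yB : y \notin B by apply/negP => yB; have : y \in A :&: B; [rewrite inE yA|rewrite ABI inE].
  have xB : x \notin B by apply/negP => xB; have := h _ _ yA xB; rewrite rt_sym xy.
  have xA : x \in A.
    have : x \in A :|: B by rewrite AB inE xK orbT.
    by rewrite inE (negPf xB) orbF.
  have ny : x != y by apply: contraNneq yK => <-.
  case: (cK (A :\ y) B) => //.
  - apply/setP => z; move/setP/(_ z): AB; rewrite !inE.
    by case: (eqVneq z y) => [->|//]; rewrite (negPf yB) (negPf yK).
  - apply/setP => z; move/setP/(_ z): ABI; rewrite !inE.
    by case: (z \in A) => /= [->|_]; rewrite ?andbF.
  - by move=> a b; rewrite inE => /andP[_]; exact: h.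
  by move/setP/(_ x); rewrite !inE ny xA.
move=> A B AB ABI h; have : y \in A :|: B by rewrite AB !inE eqxx.
rewrite inE => /orP[yA|yB]; first by right; apply: aux h yA.
left; apply: (aux B A); rewrite 1?setUC 1?setIC //.
by move=> b a hb ha; rewrite rt_sym h.
Qed.

Lemma edge_tle x y : rt_adj x y -> x != y -> tle x y -> y != rt_root T /\ par y = x.
Proof.
move=> xy nxy /tleP/(anc_leq (@par_root T) (@ht_par_lt T)) hxy.
suff e : par y = x.
  by split=> //; apply: contra nxy => /eqP ey; rewrite -e ey par_root.
move: xy; rewrite rt_adjE /padj (negPf nxy) /= => /orP[/eqP e|/eqP //].
case: (eqVneq x (rt_root T)) => [ex|/ht_par]; last by rewrite e; lia.
by rewrite -e ex par_root eqxx in nxy.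
Qed.

Lemma tle_par x : tle (par x) x.
Proof. by apply/tleP/anc_par/anc_refl. Qed.

Lemma par2_neq x : x != rt_root T -> par (par x) != x.
Proof.
move=> nx; apply/eqP => e; have := ht_par nx.
case: (eqVneq (par x) (rt_root T)) => [e'|/ht_par]; last by rewrite e; lia.
by rewrite -e e' par_root eqxx in nx.
Qed.

End Connected.

Section LightConfluent.
Variables (S T : rtree) (f : rt_V S -> rt_V T).

(** A criterion shared by light maps and splittings: all edges are parent edges, so it suffices that
    each of them is collapsed or sent to a parent edge, and that each one of the target lifts. Order
    preservation follows by iterating [par]. *)
Lemma par_epi :
  f (rt_root S) = rt_root T ->
  (forall y, f (par y) = f y \/ f (par y) = par (f y)) ->
  (forall c, exists2 y, f y = c & f (par y) = par c) -> epi f.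
Proof.
move=> froot fpar flift; split=> //.
- have aux y : rt_adj (f (par y)) (f y).
    by case: (fpar y) => ->; [apply: rt_refl|apply: adj_par].
  move=> x y; rewrite {1}rt_adjE => /or3P[]/eqP e.
  + by rewrite e rt_refl.
  + by rewrite rt_sym -e aux.
  + by rewrite -e.
- by move=> v; case: (flift v) => y <- _; exists y.
- move=> u v; rewrite rt_adjE => /or3P[]/eqP <-.
  + by case: (flift u) => y <- _; exists y, y; split=> //; apply: rt_refl.
  + by case: (flift u) => y <- <-; exists y, (par y); split=> //; rewrite rt_sym adj_par.
  + by case: (flift v) => y <- <-; exists (par y), y; split=> //; rewrite adj_par.
- move=> x y /tleP/ancP[n ->]; apply/tleP; elim: n => [|n IH] /=; first exact: anc_refl.
  by case: (fpar (iter n (@par S) y)) => ->; [|exact: connect_trans IH (fconnect1 (@par T) _)].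
Qed.

Hypothesis hf : light_par f.

Lemma light_par_epi : epi f.
Proof.
have [froot fnroot fpar flift] := hf.
apply: par_epi => // [y|c]; first by right.
(* Induction on height: the parent of [c] is lifted first, then [c] as a child of that lift. *)
have [n] := ubnP (ht c); elim: n c => // n IH c hc.
case: (eqVneq c (rt_root T)) => [->|nc].
  by exists (rt_root S); rewrite // !par_root.
have [|x fx _] := IH (par c); first by rewrite -ltnS -ht_par.
have [y py fy] := flift x c nc (esym fx).
by exists y; rewrite ?py.
Qed.

(** By maximality, the component [K] absorbs every neighbour whose image lies in [Q]. Edges at a
    point of the image lift to edges at any point above it, so no edge joins [f @: K] to the rest of
    [Q], and connectedness of [Q] makes that rest empty. *)
Lemma light_par_confluent : confluent f.
Proof.
have [froot fnroot fpar flift] := hf.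
move=> Q cQ K [KQ /set0Pn[k kK] cK maxK].
have fK : f @: K \subset Q.
  by apply/subsetP => _ /imsetP[z zK ->]; move/subsetP: KQ => /(_ _ zK); rewrite inE.
have absorb x y : x \in K -> rt_adj x y -> f y \in Q -> y \in K.
  move=> xK xy fy; rewrite -(maxK (y |: K)) ?inE ?eqxx ?subsetUr //.
    by apply/subsetP => z; rewrite !inE => /orP[/eqP -> //|/(subsetP KQ)]; rewrite inE.
  exact: connected_add xK xy.
have [|||e|e] := cQ (f @: K) (Q :\: f @: K).
- by rewrite -{2}(setID Q (f @: K)) (setIidPr fK).
- by apply/setP => z; rewrite !inE; case: (z \in f @: K); rewrite ?andbF.
- move=> _ b /imsetP[x xK ->]; rewrite inE => /andP[bK bQ]; apply: contra bK.
  rewrite rt_adjE => /or3P[]/eqP e.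
  + by rewrite -e imset_f.
  + rewrite -e -fpar imset_f // (absorb x) // 1?rt_sym ?adj_par //.
    by rewrite fpar e.
  + case: (eqVneq b (rt_root T)) => [eb|nb].
      suff -> : b = f x by rewrite imset_f.
      by rewrite -e eb par_root.
    have [y py fy] := flift x b nb e.
    by rewrite -fy imset_f // (absorb x) ?fy // -py adj_par.
- by move/setP/(_ (f k)): e; rewrite imset_f // inE.
by apply/eqP; rewrite eqEsubset fK -setD_eq0 e eqxx.
Qed.

Lemma light_par_light_confluent : light_confluent f.
Proof.
have [froot fnroot fpar flift] := hf.
split; [exact: light_par_epi| |exact: light_par_confluent].
have aux x : par x != x -> f (par x) != f x.
  move=> h; rewrite fpar par_neq // fnroot //.
  by apply: contra h => /eqP ->; rewrite par_root.
move=> x y nxy fxy; rewrite rt_adjE /padj (negPf nxy) /=.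
apply/norP; split; apply/eqP => e; subst.
  by have := aux x; rewrite eq_sym fxy eqxx => /(_ nxy).
by have := aux y; rewrite fxy eqxx => /(_ nxy).
Qed.

End LightConfluent.

(** To lift a child [c] of [f x], take the star [K] of [x] and its children over [c]. It is a
    component of the preimage of the edge from [f x] to [c], so by confluence its image contains
    [c]. *)
Lemma light_confluent_par (S T : rtree) (f : rt_V S -> rt_V T) :
  light_confluent f -> light_par f.
Proof.
case=> -[fadj _ _ froot fle] fl fc.
have step x : x != rt_root S -> f x != rt_root T /\ f (par x) = par (f x).
  move=> nx; have := edge_tle (fadj _ _ (adj_par x)) _ (fle _ _ (tle_par x)).
  case=> [|? ->] //; apply/eqP => e.
  by have := fl _ _ (par_neq nx) e; rewrite adj_par.
have fnroot x : x != rt_root S -> f x != rt_root T by case/step.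
have fpar x : f (par x) = par (f x).
  by case: (eqVneq x (rt_root S)) => [->|/step[] //]; rewrite par_root froot par_root.
split=> // x c nc pc.
pose K := [set z | (z == x) || (par z == x) && (f z == c)].
have xK : x \in K by rewrite inE eqxx.
have cadj : rt_adj (f x) c by rewrite -pc adj_par.
have ncfx : f x != c by rewrite -pc par_neq.
have fxc : par (f x) != c by rewrite -pc par2_neq.
have cQ : connected_set [set f x; c].
  by apply: (@connected_star _ _ (f x)) => [|z]; rewrite !inE ?eqxx // => /orP[]/eqP ->;
    rewrite ?rt_refl.
have Kpre : K \subset f @^-1: [set f x; c].
  apply/subsetP => z; rewrite !inE => /orP[/eqP ->|/andP[_ ->]]; first by rewrite eqxx.
  by rewrite orbT.
have cK : connected_set K.
  apply: (connected_star xK) => z; rewrite inE => /orP[/eqP ->|/andP[/eqP <- _]].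
    exact: rt_refl.
  exact: adj_par.
(* No edge leaves [K] inside the preimage. By lightness a neighbour of [x] there lies over [c], and
   it is not the parent of [x], whose image is [par (f x)]. A neighbour of a child over [c] lies
   over [f x], so it is not a child of that child and must be [x]. *)
have Kcomp : component (f @^-1: [set f x; c]) K.
  split=> //; first by apply/set0Pn; exists x.
  move=> L KL LQ cL; have [||||e] := cL K (L :\: K).
  - by rewrite -{2}(setID L K) (setIidPr KL).
  - by apply/setP => z; rewrite !inE; case: (_ || _); rewrite ?andbF.
  - move=> a b aK; rewrite inE => /andP[bK /(subsetP LQ)]; rewrite !inE => fb.
    apply: contra bK => ab.
    have nab : a == b \/ f a != f b.
      case: (eqVneq a b) => [|n]; [by left|right].
      by apply/eqP => e; have := fl _ _ n e; rewrite ab.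
    move: aK; rewrite !inE => /orP[/eqP ea|/andP[/eqP pa /eqP fa]].
      subst a; case: nab => [/eqP -> |nab]; first by rewrite eqxx.
      move: fb; rewrite eq_sym (negPf nab) /= => /eqP fb; rewrite fb eqxx andbT.
      move: ab; rewrite rt_adjE => /or3P[/eqP ->|/eqP e|->]; rewrite ?eqxx ?orbT //.
      by rewrite -fb -e fpar eqxx in fxc.
    case: nab => [/eqP <- |]; first by rewrite pa fa !eqxx orbT.
    rewrite fa eq_sym => nab; move: fb; rewrite (negPf nab) orbF => /eqP fb.
    move: ab; rewrite rt_adjE => /or3P[/eqP e|/eqP <-|/eqP e].
    + by rewrite -e fa eqxx in nab.
    + by rewrite pa eqxx.
    + by move: fxc; rewrite -fb -fpar e fa eqxx.
  - by move=> e; rewrite e inE in xK.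
  by apply/eqP; rewrite eqEsubset KL -setD_eq0 e eqxx.
have := fc _ cQ _ Kcomp; move/setP/(_ c); rewrite !inE eqxx orbT.
case/imsetP => y; rewrite inE => /orP[/eqP ->|/andP[/eqP py /eqP fy]] ec.
  by rewrite -ec eqxx in ncfx.
by exists y.
Qed.

(** * Isomorphisms, and closure under composition *)

Lemma tree_iso_id (T : rtree) : tree_iso (fun x : rt_V T => x).
Proof. by split=> //; exists id. Qed.

Lemma tree_iso_root (S T : rtree) (f : rt_V S -> rt_V T) x :
  tree_iso f -> (f x == rt_root T) = (x == rt_root S).
Proof. by case=> /bij_inj finj <- _; rewrite inj_eq. Qed.

Lemma tree_iso_inv (S T : rtree) (f : rt_V S -> rt_V T) : tree_iso f ->
  exists g : rt_V T -> rt_V S, [/\ tree_iso g, cancel f g & cancel g f].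
Proof.
case=> -[g fK gK] froot fpar; exists g; split=> //; split; first by exists f.
  by rewrite -froot.
by move=> x; rewrite -{1}[x]gK -fpar fK.
Qed.

Lemma tree_iso_light_par (S T : rtree) (f : rt_V S -> rt_V T) :
  tree_iso f -> light_par f.
Proof.
move=> fi; case: (fi) => -[g fK gK] froot fpar.
split=> // [x|x c nc pc]; first by rewrite tree_iso_root.
by exists (g c); rewrite // -[par _]fK fpar gK pc fK.
Qed.

Lemma light_par_comp (S U T : rtree) (f : rt_V U -> rt_V T) (g : rt_V S -> rt_V U) :
  light_par f -> light_par g -> light_par (f \o g).
Proof.
case=> f1 f2 f3 f4 [g1 g2 g3 g4]; split=> /=.
- by rewrite g1.
- by move=> x /g2 /f2.
- by move=> x; rewrite g3.
move=> x c nc /(f4 _ _ nc)[y py fy].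
have ny : y != rt_root U by apply: contra nc => /eqP e; rewrite -fy e f1.
by have [z pz gz] := g4 _ _ ny py; exists z; rewrite // gz.
Qed.

Lemma splits_iso (S U T : rtree) (f : rt_V U -> rt_V T) (g : rt_V S -> rt_V U) x c :
  tree_iso f -> splits g x c -> splits (f \o g) x c.
Proof.
case=> [fb f1 f2] [h1 h2 h3 h4 h5 h6 h7 h8 h9]; split=> //=.
- by rewrite h4.
- by move=> u v hu hv /(bij_inj fb); exact: h5.
- case: fb => f' fK f'K w; have [u hu e] := h6 (f' w).
  by exists u; rewrite // e.
- by move=> v hv hv'; rewrite h7.
- by rewrite h8.
by case: h9 => ->; [left|right].
Qed.

Lemma tree_iso_comp (S U T : rtree) (f : rt_V U -> rt_V T) (g : rt_V S -> rt_V U) :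
  tree_iso f -> tree_iso g -> tree_iso (f \o g).
Proof.
case=> fb f1 f2 [gb g1 g2]; split; first exact: bij_comp.
  by rewrite /= g1.
by move=> x; rewrite /= g2.
Qed.

(** * Splitting edge maps *)

Section Splits.
Variables (S T : rtree) (f : rt_V S -> rt_V T).

Section Facts.
Variables (x c : rt_V S).
Hypothesis hf : splits f x c.

Lemma splits_child_new : c != x.
Proof.
have := splits_child hf; apply: contra_eqN => /eqP ->.
by rewrite par_neq // (splits_new hf).
Qed.

Lemma splits_parent_new : par x != x.
Proof. by rewrite par_neq // (splits_new hf). Qed.

Lemma splits_eq u v : u != x -> v != x -> (f u == f v) = (u == v).
Proof.
by move=> hu hv; apply/eqP/eqP => [/(splits_inj hf hu hv)|->].
Qed.

Lemma splits_child_root : f c != rt_root T.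
Proof.
rewrite -(splits_root hf) splits_eq ?splits_child_new // 1?eq_sym ?(splits_new hf) //.
have := splits_child hf; apply: contra_eqN => /eqP <-.
by rewrite par_root eq_sym (splits_new hf).
Qed.

Lemma splits_epi : epi f.
Proof.
apply: par_epi; first exact: splits_root hf.
  move=> y; case: (eqVneq y x) => [->|nyx].
    by case: (splits_image hf) => e; [right|left]; rewrite e // (splits_edge hf).
  case: (eqVneq y c) => [->|nyc]; last by right; rewrite (splits_par hf).
  by rewrite (splits_child hf); case: (splits_image hf) => ->;
    [left|right; rewrite (splits_edge hf)].
move=> w; have [u nu <-] := splits_surj hf w.
case: (eqVneq u c) => [->|nuc]; last by exists u; rewrite // (splits_par hf).
(* The split edge of the target lifts to whichever half of it is not collapsed: the half above [x]
   if [x] goes to [f c], the half below otherwise. *)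
case: (splits_image hf) => e; first by exists x; rewrite // (splits_edge hf).
by exists c; rewrite // (splits_child hf) e (splits_edge hf).
Qed.

Lemma splits_splitting : splitting_edge_map f.
Proof.
have ncx := splits_child_new; have npx := splits_parent_new.
have nfc := splits_child_root.
exists x, (f (par x)), (f c); split.
  by rewrite (splits_edge hf); split; rewrite ?adj_par ?par_neq //; exact: tle_par.
split; first exact: splits_new hf.
split; first exact: splits_root hf.
split; first exact: splits_inj hf.
split; first exact: splits_surj hf.
split; last first.
  split.
    move=> v nv; rewrite !splits_eq // rt_adjE /padj eq_sym (negPf nv) /=.
    rewrite eq_sym; congr (_ || _).
    by apply/eqP/eqP => [/(splits_only_child hf)|->]; rewrite ?(splits_child hf).
  by case: (splits_image hf) => ->; rewrite eqxx ?orbT.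
have npc : par x != c.
  apply/eqP => e; have := ht_par (splits_new hf); have := splits_child hf.
  case: (eqVneq c (rt_root S)) => [ec|/ht_par].
    by rewrite ec par_root => ex; have := splits_new hf; rewrite ex eqxx.
  by move=> h1 h2; rewrite h2 in h1; rewrite e; lia.
(* Away from [x], the map [f] preserves and reflects the parent relation except for the pair [c],
   [par x], which becomes the edge that was split. *)
have key u v : u != x -> v != x ->
    (par u == v) = (par (f u) == f v) && ~~ ((u == c) && (v == par x)).
  move=> hu hv; case: (eqVneq u c) => [->|nuc] /=.
    rewrite (splits_child hf) eq_sym (negPf hv) -(splits_edge hf) splits_eq // eq_sym.
    by rewrite andbN.
  rewrite andbT -(splits_par hf) // splits_eq //.
  by apply: contra nuc => /eqP /(splits_only_child hf) ->.
have far u v : (u == c) && (v == par x) -> par (f v) == f u = false.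
  by move=> /andP[/eqP -> /eqP ->]; rewrite (splits_edge hf) (negPf (par2_neq nfc)).
have loop u v : (u == c) && (v == par x) -> u == v = false.
  by move=> /andP[/eqP -> /eqP ->]; rewrite eq_sym (negPf npc).
move=> u v hu hv; rewrite !splits_eq //.
rewrite !rt_adjE /padj !splits_eq // (key u v) // (key v u) // [(u == par x) && _]andbC.
move: (far u v) (loop u v) (far v u) (loop v u); rewrite [v == u]eq_sym.
case: ((u == c) && _) => [/(_ isT) -> /(_ isT) ->|_ _].
  by rewrite !orbT !andbF /=.
case: ((v == c) && _) => [/(_ isT) -> /(_ isT) -> //|_ _].
by rewrite !andbT.
Qed.

End Facts.

Lemma splitting_splits : splitting_edge_map f -> exists x c, splits f x c.
Proof.
case=> x [a [b [[ab nab tab] [nx [froot [finj [fsurj [fadj [xadj fx]]]]]]]]].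
have [nb pb] := edge_tle ab nab tab.
have [a' na' fa'] := fsurj a; have [b' nb' fb'] := fsurj b.
have feq u v : u != x -> v != x -> (f u == f v) = (u == v).
  by move=> hu hv; apply/eqP/eqP => [/(finj _ _ hu hv)|->].
have xadj' v : v != x -> rt_adj x v = (v == a') || (v == b').
  by move=> nv; rewrite xadj // -fa' -fb' !feq.
have npx := par_neq nx.
have nab' : a' != b' by apply: contraNneq nab => e; rewrite -fa' -fb' e.
(* If [b'] were the parent of [x], the way from [b'] to the root would avoid [x]. Its image would
   then never use the edge from [b] to [a], the only exit from the descendants of [b], and yet would
   reach the root. *)
have not_up : par x != b'.
  apply/eqP => px.
  have pa' : par a' = x.
    have : rt_adj x a' by rewrite xadj' ?eqxx.
    rewrite rt_adjE /padj eq_sym (negPf na') px eq_sym (negPf nab') /=.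
    by move/eqP.
  have nancx n : iter n (@par S) b' != x.
    apply/eqP => e; have : anc (@par S) x b' by apply/ancP; exists n.
    rewrite -px; apply/negP; exact: anc_parN (@par_root S) (@ht_par_lt S) _ nx.
  have /ancP[n en] := anc_root (@ht_par_lt S) b'.
  have : anc (@par T) b (rt_root T).
    rewrite -froot en; elim: n {en} => [|n IH] /=.
      by rewrite fb' anc_refl.
    have n1 := nancx n; have n2 := nancx n.+1; rewrite /= in n2.
    have := adj_par (iter n (@par S) b'); rewrite fadj // rt_sym => /andP[h1 h2].
    apply: contraNT h2; rewrite rt_adjE in h1 => /(anc_exit IH h1)[-> ->].
    by rewrite pb !eqxx.
  move/(anc_leq (@par_root T) (@ht_par_lt T)); rewrite ht_root.
  by rewrite (ht_par nb).
have px : par x = a'.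
  have : rt_adj x (par x) by rewrite rt_sym adj_par.
  by rewrite xadj' // (negPf not_up) orbF => /eqP.
have pb' : par b' = x.
  have : rt_adj x b' by rewrite xadj' ?eqxx ?orbT.
  by rewrite rt_adjE /padj eq_sym (negPf nb') px (negPf nab') => /eqP.
have only v : par v = x -> v = b'.
  move=> pv; have nv : v != x.
    by apply/eqP => e; rewrite e in pv; rewrite pv eqxx in npx.
  have : rt_adj x v by rewrite -pv adj_par.
  rewrite xadj' // => /orP[]/eqP // e.
  by have := par2_neq nx; rewrite px -e pv eqxx.
(* Induction on height. The edge from [par v] to [v] has an edge as image; were it reversed, then
   either [par v = b'], which forces [v = a'] and a cycle of length three under [par], or the
   induction hypothesis gives [par (par v) = v]. *)
have parE v : v != x -> v != b' -> f (par v) = par (f v).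
  have [n] := ubnP (ht v); elim: n v => // n IH v hv nv nvb.
  case: (eqVneq v (rt_root S)) => [->|nvr]; first by rewrite par_root froot par_root.
  have npv : par v != x by apply: contra nvb => /eqP/only ->.
  have := adj_par v; rewrite fadj // => /andP[].
  rewrite rt_adjE /padj feq // (negPf (par_neq nvr)) /= => /orP[/eqP e _|/eqP //].
  exfalso; move: e; case: (eqVneq (par v) b') => [e''|npvb].
    rewrite e'' fb' pb -fa' => /eqP; rewrite feq // => /eqP ev.
    have nbr : b' != rt_root S by apply: contra nb => /eqP e; rewrite -fb' e froot.
    have : ht v = (ht v).+3.
      by rewrite {1}(ht_par nvr) e'' (ht_par nbr) pb' (ht_par nx) px ev.
    by elim: (ht v) => // k IHk [/IHk].
  rewrite -IH //; last by rewrite -ltnS -ht_par.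
  move/eqP; rewrite feq //; first by rewrite (negPf (par2_neq nvr)).
  by apply: contra npvb => /eqP/only ->.
exists x, b'; split=> //; first by rewrite px fb' pb fa'.
by rewrite px fa' fb'; case/orP: fx => /eqP; [right|left].
Qed.
End Splits.

(** * Subdivisions *)

Section RestrictedTree.
Variables (U : finType) (ok : pred U) (p : U -> U) (r : U) (m : U -> nat).
Hypotheses (okr : ok r) (okp : forall u, ok u -> ok (p u)) (pr : p r = r).
Hypothesis plt : forall u, ok u -> u != r -> m (p u) < m u.

Let sub_par (x : {u | ok u}) : {u | ok u} := exist ok (p (val x)) (okp (valP x)).
Let sub_root : {u | ok u} := exist ok r okr.

Fact sub_par_root : sub_par sub_root = sub_root.
Proof. by apply: val_inj; rewrite /= pr. Qed.

Fact sub_par_lt x : x != sub_root -> m (val (sub_par x)) < m (val x).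
Proof. by move=> nx; apply: plt (valP x) _; rewrite -(inj_eq val_inj) in nx. Qed.

Definition restricted_tree : rtree :=
  @parent_tree _ sub_par sub_root (m \o val) sub_par_root sub_par_lt.

Definition tval (x : rt_V restricted_tree) : U := val (x : {u | ok u}).

Definition tmk u (h : ok u) : rt_V restricted_tree := exist ok u h.

Lemma tvalK u (h : ok u) : tval (tmk h) = u.
Proof. by []. Qed.

Lemma tvalP x : ok (tval x).
Proof. exact: valP. Qed.

Lemma tval_inj : injective tval.
Proof. exact: val_inj. Qed.

Lemma tval_root : tval (rt_root restricted_tree) = r.
Proof. by []. Qed.

Lemma tval_par x : tval (par x) = p (tval x).
Proof.
by rewrite (@par_unique restricted_tree _ (m \o val) sub_par_root sub_par_lt).
Qed.

Lemma tval_eq_root x : (x == rt_root restricted_tree) = (tval x == r).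
Proof. by rewrite -(inj_eq tval_inj). Qed.
End RestrictedTree.

Section Subdivision.
Variable T : rtree.
Notation V := (rt_V T).
Notation U := (V + V * bool)%type.
Implicit Types (P Q : {set V * bool}) (b : V) (u : U).

(* [inr (b, i)] is a new vertex on the edge from [par b] to [b]: below the
   midpoint, hence projected to [b], if [i] is true, and above the midpoint,
   hence projected to [par b], if [i] is false.  The tree [subdivide P] has the
   new vertices in [P]; pairs whose first component is the root are ignored. *)

Definition sd_ok P u :=
  if u is inr q then (q \in P) && (q.1 != rt_root T) else true.

(** The first vertex met beyond the midpoint when going from [b] towards the root. *)
Definition sd_upper P b : U :=
  if (b, false) \in P then inr (b, false) else inl (par b).

Definition sd_par P u : U :=
  match u with
  | inl b => if b == rt_root T then inl b
             else if (b, true) \in P then inr (b, true) else sd_upper P b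
  | inr (b, true) => sd_upper P b
  | inr (b, false) => inl (par b)
  end.

(** For [b] not the root, the vertices [par b], [(b, false)], [(b, true)], [b] receive four
    consecutive values. *)
Definition sd_measure u :=
  match u with inl b => 3 * ht b + 2 | inr (b, i) => 3 * ht b + i end.

Definition sd_proj u : V :=
  match u with inl b => b | inr (b, true) => b | inr (b, false) => par b end.

Fact sd_ok_root P : sd_ok P (inl (rt_root T)).
Proof. by []. Qed.

Fact sd_ok_par P u : sd_ok P u -> sd_ok P (sd_par P u).
Proof.
case: u => [b|[b []]] //=; rewrite /sd_upper.
  case: (eqVneq b (rt_root T)) => //= nb _.
  case: ifP => [h|_] /=; first by rewrite h nb.
  by case: ifP => [h|_] //=; rewrite h nb.
by case: ifP => //= -> /andP[].
Qed.

Fact sd_par_root P : sd_par P (inl (rt_root T)) = inl (rt_root T).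
Proof. by rewrite /= eqxx. Qed.

Fact sd_par_lt P u : sd_ok P u -> u != inl (rt_root T) ->
  sd_measure (sd_par P u) < sd_measure u.
Proof.
case: u => [b|[b []]] /=; rewrite /sd_upper.
- move=> _ nb; have {}nb : b != rt_root T by [].
  rewrite (negPf nb) (ht_par nb).
  by case: ifP => _ /=; [|case: ifP => _ /=]; rewrite ?(ht_par nb); lia.
- case/andP=> _ nb _; rewrite (ht_par nb).
  by case: ifP => _ /=; rewrite ?(ht_par nb); lia.
- by case/andP=> _ nb _; rewrite (ht_par nb); lia.
Qed.

Definition subdivide P : rtree :=
  restricted_tree (sd_ok_root P) (@sd_ok_par P) (sd_par_root P) (@sd_par_lt P).

Definition sd_pi P (x : rt_V (subdivide P)) : V := sd_proj (tval x).

(** A forgotten new vertex moves to the endpoint on its own side of the midpoint, so it never jumps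
    over the other new vertex of the same edge. *)
Definition sd_retr_raw P u : U := if sd_ok P u then u else inl (sd_proj u).

Fact sd_retr_ok P u : sd_ok P (sd_retr_raw P u).
Proof. by rewrite /sd_retr_raw; case: ifP. Qed.

Definition sd_mk P u (h : sd_ok P u) : rt_V (subdivide P) :=
  tmk (sd_ok_root P) (@sd_ok_par P) (sd_par_root P) (@sd_par_lt P) h.

Definition sd_retr Q P (x : rt_V (subdivide Q)) : rt_V (subdivide P) :=
  sd_mk (sd_retr_ok P (tval x)).

Lemma sd_pi_retr Q P x : sd_pi (@sd_retr Q P x) = sd_pi x.
Proof. by rewrite /sd_pi tvalK /sd_retr_raw; case: ifP. Qed.

Lemma sd_retr_id P : @sd_retr P P =1 id.
Proof.
by move=> x; apply: tval_inj; rewrite tvalK /sd_retr_raw tvalP.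
Qed.

Lemma sd_pi0_iso : tree_iso (@sd_pi set0).
Proof.
split=> // [|x].
  exists (fun b => @sd_mk set0 (inl b) isT) => // x.
  apply: tval_inj; rewrite tvalK /sd_pi.
  by have := tvalP x; case: (tval x) => //= q; rewrite inE.
rewrite /sd_pi tval_par; have := tvalP x; case: (tval x) => [b|q] /=; last by rewrite inE.
by rewrite /sd_upper !inE; case: eqP => //= ->; rewrite par_root.
Qed.

Lemma sd_eq P (x y : rt_V (subdivide P)) : (x == y) = (tval x == tval y).
Proof. by rewrite (inj_eq (@tval_inj _ _ _ _ _ _ _ _ _)). Qed.

Section OneMore.
Variables (P : {set V * bool}) (q : V * bool).
Hypotheses (qP : q \notin P) (nq : q.1 != rt_root T).
Let Q := q |: P.

(** The only child of the new vertex [q] once it has been added to [P]. *)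
Definition sd_below : U :=
  if ~~ q.2 && ((q.1, true) \in P) then inr (q.1, true) else inl q.1.

Fact sd_ok_below : sd_ok P sd_below.
Proof. by rewrite /sd_below; case: ifP => //= /andP[_ ->]. Qed.

Lemma sd_okU u : sd_ok Q u = (u == inr q) || sd_ok P u.
Proof.
case: u => [b|q'] //=; rewrite in_setU1 -[inr q' == _]/(q' == q).
by case: (eqVneq q' q) => [->|//]; rewrite nq.
Qed.

Lemma sd_par_below : sd_par Q sd_below = inr q.
Proof.
move: qP nq; rewrite /sd_below /Q; case: q => b [] /= h nb.
  by rewrite (negPf nb) setU11.
case: ifP => /= hb; rewrite /sd_upper setU11 // (negPf nb).
by rewrite in_setU1 xpair_eqE andbF hb.
Qed.

Lemma sd_par_only_below u : sd_ok Q u -> sd_par Q u = inr q -> u = sd_below.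
Proof.
move: qP nq; rewrite /sd_below /Q; case: q => b0 i /= h0 nb0.
case: u => [b|[b []]] //=; rewrite /sd_upper.
- case: (eqVneq b (rt_root T)) => // nb _.
  case: ifP => [hb [-> <-]//|hb].
  case: ifP => // hb' [eb ei]; subst b0 i => /=.
  by move: hb; rewrite in_setU1 => /norP[_ /negPf ->].
- move=> /andP[hb nb]; case: ifP => // hb' [eb ei]; subst b0 i => /=.
  by move: hb; rewrite in_setU1 xpair_eqE andbF /= => ->.
Qed.

Lemma sd_par_other u : sd_ok P u -> u != sd_below -> sd_par Q u = sd_par P u.
Proof.
move: qP nq; rewrite /sd_below /Q; case: q => b0 i /= h0 nb0.
case: u => [b|[b []]] //=; rewrite /sd_upper !in_setU1 !xpair_eqE.
  case: (eqVneq b (rt_root T)) => // nb _.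
  case: (eqVneq b b0) => [->|//]; case: i h0 => /= h0; first by rewrite eqxx.
  by case: ((b0, true) \in P) => //; rewrite eqxx.
move=> /andP[hb nb]; case: (eqVneq b b0) => [eb|//]; rewrite -eb in h0 *.
case: i h0 => /= h0; first by rewrite hb in h0.
by rewrite hb eqxx.
Qed.

Lemma sd_par_new : sd_par Q (inr q) = sd_par P sd_below.
Proof.
move: qP nq; rewrite /sd_below /Q; case: q => b0 i /= h0 nb0.
case: i h0 => /= h0.
  by rewrite /sd_upper (negPf nb0) (negPf h0) in_setU1 xpair_eqE andbF.
case: ifP => /= hb; rewrite /sd_upper ?(negPf h0) //.
by rewrite (negPf nb0) hb.
Qed.

Lemma sd_retr_splits : exists x c, splits (@sd_retr Q P) x c.
Proof.
have xok : sd_ok Q (inr q) by rewrite sd_okU eqxx.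
have cok : sd_ok Q sd_below by rewrite sd_okU sd_ok_below orbT.
have nxP : ~~ sd_ok P (inr q) by rewrite /= (negPf qP).
have okP (v : rt_V (subdivide Q)) : v != sd_mk xok -> sd_ok P (tval v).
  by move=> nv; have := tvalP v; rewrite sd_okU => /orP[|//]; rewrite sd_eq tvalK in nv *;
    rewrite (negPf nv).
have retrE (v : rt_V (subdivide Q)) : sd_ok P (tval v) -> tval (@sd_retr Q P v) = tval v.
  by move=> h; rewrite tvalK /sd_retr_raw h.
exists (sd_mk xok), (sd_mk cok); split.
- by [].
- by apply: tval_inj; rewrite tval_par !tvalK sd_par_below.
- move=> v /(congr1 (@tval _ _ _ _ _ _ _ _ _)); rewrite tval_par !tvalK.
  by move=> /(sd_par_only_below (tvalP v)) e; apply: tval_inj.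
- by apply: tval_inj; rewrite retrE.
- move=> u v /okP hu /okP hv /(congr1 (@tval _ _ _ _ _ _ _ _ _)); rewrite !retrE //.
  exact: tval_inj.
- move=> w; have wok : sd_ok Q (tval w) by rewrite sd_okU tvalP orbT.
  exists (sd_mk wok); last by apply: tval_inj; rewrite retrE ?tvalK // tvalP.
  rewrite sd_eq !tvalK.
  by apply: contraNneq nxP => <-; apply: tvalP.
- move=> v nx nc; have hv := okP v nx; apply: tval_inj.
  have e : sd_par Q (tval v) = sd_par P (tval v).
    by apply: sd_par_other.
  by rewrite tval_par !retrE // tval_par e // sd_ok_par.
- apply: tval_inj; rewrite tval_par !retrE ?tval_par ?tvalK ?sd_par_new //.
  + exact: sd_ok_below.
  + exact/sd_ok_par/sd_ok_below.
- have parx : tval (@sd_retr Q P (par (sd_mk xok))) = sd_par P sd_below.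
    by rewrite retrE tval_par tvalK sd_par_new ?sd_ok_par ?sd_ok_below.
  have cval : tval (@sd_retr Q P (sd_mk cok)) = sd_below.
    by rewrite retrE ?tvalK // sd_ok_below.
  have xval : tval (@sd_retr Q P (sd_mk xok)) = inl (sd_proj (inr q)).
    by rewrite tvalK /sd_retr_raw tvalK (negPf nxP).
  (* A new vertex in the lower half retracts to its child, one in the upper half to its parent. *)
  case eq2 : q.2; [left|right]; apply: tval_inj; rewrite xval ?parx ?cval.
    by rewrite /sd_below; case: q eq2 => b i /= ->.
  by rewrite -sd_par_new; case: q eq2 => b i /= ->.
Qed.
End OneMore.
End Subdivision.

(** * Elementary amalgamations *)

Section LiftLight.
Variables (B A : rtree) (l : rt_V B -> rt_V A) (P : {set rt_V A * bool}).
Hypothesis hl : light_par l.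

Definition sd_preim : {set rt_V B * bool} := [set q | (l q.1, q.2) \in P].

Definition sd_map_raw (u : rt_V B + rt_V B * bool) : rt_V A + rt_V A * bool :=
  match u with inl b => inl (l b) | inr q => inr (l q.1, q.2) end.

Lemma light_par_eq_root b : (l b == rt_root A) = (b == rt_root B).
Proof.
case: hl => lr lnr _ _; case: (eqVneq b (rt_root B)) => [->|/lnr/negPf //].
by rewrite lr eqxx.
Qed.

Fact sd_map_ok u : sd_ok sd_preim u -> sd_ok P (sd_map_raw u).
Proof. by case: u => //= q; rewrite inE light_par_eq_root. Qed.

Definition sd_map (x : rt_V (subdivide sd_preim)) : rt_V (subdivide P) :=
  sd_mk (sd_map_ok (tvalP x)).

Lemma sd_map_par_raw u : sd_map_raw (sd_par sd_preim u) = sd_par P (sd_map_raw u).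
Proof.
have [_ _ lpar _] := hl.
case: u => [b|[b []]] /=; rewrite /sd_upper ?light_par_eq_root ?inE /= -?lpar //.
  by case: eqP => // _; case: ifP => // _; case: ifP.
by case: ifP.
Qed.

Lemma sd_map_light : light_par sd_map.
Proof.
have [lr lnr lpar llift] := hl; split.
- by apply: tval_inj; rewrite tvalK !tval_root /= lr.
- move=> x; rewrite !tval_eq_root tvalK; case: (tval x) => [b|q] // nb.
  by have := lnr b nb; apply: contra => /eqP [->].
- by move=> x; apply: tval_inj; rewrite tval_par !tvalK tval_par sd_map_par_raw.
move=> x c nc /(congr1 (@tval _ _ _ _ _ _ _ _ _)); rewrite tval_par tvalK => e.
suff [v [vok pv fv]] : exists v, [/\ sd_ok sd_preim v, sd_par sd_preim v = tval x
    & sd_map_raw v = tval c].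
  exists (sd_mk vok); apply: tval_inj; first by rewrite tval_par tvalK.
  by rewrite !tvalK.
have cok := tvalP c; rewrite tval_eq_root in nc.
have xok := tvalP x.
move: (tval x) (tval c) e nc cok xok => u w e nw wok uok.
(* The lift depends on the parent of the child to be lifted. If it is an original vertex, [l] lifts
   the child ([step]); if it is a new vertex, the edge of [B] carrying [u] already determines the
   lift ([here]). *)
have step b : b != rt_root A -> inl (par b) = sd_map_raw u ->
    exists b', [/\ b' != rt_root B, u = inl (par b') & l b' = b].
  move=> nb; case: u {e uok} => //= b1 [eb]; have [b2 <- fb2] := llift _ _ nb eb.
  exists b2; split=> //; by rewrite -light_par_eq_root fb2.
have here b i : inr (b, i) = sd_map_raw u ->
    exists b', [/\ b' != rt_root B, u = inr (b', i) & l b' = b].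
  case: u {e step} uok => //= -[b' i'] /= /andP[_ nb'] [-> ->].
  by exists b'.
have lift_upper b : b != rt_root A -> sd_upper P b = sd_map_raw u ->
    exists b', [/\ b' != rt_root B, u = sd_upper sd_preim b' & l b' = b].
  move=> nb; rewrite /sd_upper; case: ifP => hb.
    by case/here => b' [nb' -> eb]; exists b'; rewrite inE /= eb hb.
  by case/step => // b' [nb' -> eb]; exists b'; rewrite inE /= eb hb.
case: w e nw wok => [b|[b []]] /=.
- move=> + nw _; have nb : b != rt_root A by [].
  rewrite (negPf nb); case: ifP => hb.
    case/here => b' [nb' -> eb]; exists (inl b').
    by rewrite /= (negPf nb') inE /= eb hb.
  case/lift_upper => // b' [nb' -> eb]; exists (inl b').
  by rewrite /= (negPf nb') inE /= eb hb.
- move=> + _ /andP[hb nb]; case/lift_upper => // b' [nb' -> eb].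
  by exists (inr (b', true)); rewrite /= inE /= eb hb nb'.
- move=> + _ /andP[hb nb]; case/step => // b' [nb' -> eb].
  by exists (inr (b', false)); rewrite /= inE /= eb hb nb'.
Qed.

Lemma sd_pi_map x : sd_pi (sd_map x) = l (sd_pi x).
Proof.
have [_ _ lpar _] := hl.
by rewrite /sd_pi tvalK; case: (tval x) => [b|[b []]] //=; rewrite lpar.
Qed.

End LiftLight.

Lemma inj_surj_bij (X Y : finType) (f : X -> Y) :
  injective f -> (forall y, exists x, f x = y) -> bijective f.
Proof.
move=> finj /fin_all_exists[g gK]; exists g => // x.
by apply: finj; rewrite gK.
Qed.

Section SplitsSubdivide.
Variables (S T : rtree) (f : rt_V S -> rt_V T) (x c : rt_V S).
Hypothesis hf : splits f x c.

(** Up to isomorphism, every splitting is the projection of a subdivision at one point; thus several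
    splittings of [T] can be performed together. *)
Lemma splits_subdivide : exists q (h : rt_V (subdivide [set q]) -> rt_V S),
  [/\ q.1 != rt_root T, tree_iso h & forall v, f (h v) = sd_pi v].
Proof.
(* The edge is named by its lower end [f c]; the flag records whether [x] is sent there. *)
pose q := (f c, f x == f c).
have nq : q.1 != rt_root T by apply: splits_child_root hf.
have ncx := splits_child_new hf; have npx := splits_parent_new hf.
pose raw v : rt_V T + rt_V T * bool := if v == x then inr q else inl (f v).
have rok v : sd_ok [set q] (raw v) by rewrite /raw; case: ifP => //= _; rewrite set11.
pose phi v : rt_V (subdivide [set q]) := sd_mk (rok v).
have phi_par v : phi (par v) = par (phi v).
  apply: tval_inj; rewrite tval_par !tvalK /raw.
  have hup : sd_par [set q] (inr q) = inl (f (par x)).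
    rewrite (splits_edge hf) /q; case: (f x == f c) => //=.
    by rewrite /sd_upper inE xpair_eqE andbF.
  case: (eqVneq v x) => [->|nvx]; first by rewrite (negPf npx) hup.
  case: (eqVneq v c) => [->|nvc].
    rewrite (splits_child hf) eqxx /= (negPf nq) /sd_upper !inE !xpair_eqE !eqxx /=.
    by rewrite /q; case: (f x == f c).
  case: (eqVneq (par v) x) => [/(splits_only_child hf) e|npv]; first by rewrite e eqxx in nvc.
  rewrite (splits_par hf) //= /sd_upper !inE !xpair_eqE (splits_eq hf) // (negPf nvc) /=.
  by case: eqP => // ->; rewrite par_root.
have phi_bij : bijective phi.
  apply: inj_surj_bij.
    move=> u v /(congr1 (@tval _ _ _ _ _ _ _ _ _)); rewrite !tvalK /raw.
    case: (eqVneq u x) => [->|nu]; case: (eqVneq v x) => [->|nv] //.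
    by case=> /(splits_inj hf nu nv).
  move=> w; have := tvalP w; case e: (tval w) => [b|q'] /=.
    have [u nu fu] := splits_surj hf b; exists u; apply: tval_inj.
    by rewrite tvalK /raw (negPf nu) fu.
  by rewrite inE => /andP[/eqP eq' _]; exists x; apply: tval_inj; rewrite tvalK /raw eqxx e eq'.
have phi_iso : tree_iso phi.
  split=> //; apply: tval_inj; rewrite tvalK /raw eq_sym (negPf (splits_new hf)).
  by rewrite (splits_root hf).
have [h [hi phiK hK]] := tree_iso_inv phi_iso.
exists q, h; split=> // v; rewrite -{2}[v]hK /sd_pi tvalK /raw.
case: (eqVneq (h v) x) => [->|//]; rewrite /q.
by case: (splits_image hf) => e; rewrite ?e ?eqxx //=; case: eqP => // _; rewrite -(splits_edge hf).
Qed.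

End SplitsSubdivide.

(** * Fibre products of light maps *)

Section Pullback.
Variables (A B C : rtree) (f : rt_V B -> rt_V A) (g : rt_V C -> rt_V A).
Hypotheses (hf : light_par f) (hg : light_par g).
Notation U := (rt_V B * rt_V C)%type.

Let ok (u : U) := f u.1 == g u.2.
Let p (u : U) : U := (par u.1, par u.2).
Let r : U := (rt_root B, rt_root C).

Fact pb_ok_root : ok r.
Proof. by case: hf hg => fr _ _ _ [gr _ _ _]; rewrite /ok fr gr. Qed.

Fact pb_ok_par u : ok u -> ok (p u).
Proof.
by case: hf hg => _ _ fp _ [_ _ gp _] /eqP h; rewrite /ok fp gp h.
Qed.

Fact pb_par_root : p r = r.
Proof. by rewrite /p !par_root. Qed.

(** Only the root lies over the root under a light map, so both coordinates reach their roots
    together. Hence the height of the first coordinate is a valid measure. *)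
Fact pb_root1 u : ok u -> u.1 = rt_root B -> u = r.
Proof.
case: u => b c /eqP /= e eb; rewrite /r eb; congr pair; apply/eqP.
rewrite -(light_par_eq_root hg) -e eb (light_par_eq_root hf) //.
Qed.

Fact pb_par_lt u : ok u -> u != r -> ht (p u).1 < ht u.1.
Proof.
by move=> h nu; apply: ht_par_lt; apply: contra nu => /eqP /(pb_root1 h) ->.
Qed.

Definition pullback := restricted_tree pb_ok_root pb_ok_par pb_par_root pb_par_lt.

(** A child [b] of the first coordinate has as image a child of the common image, which [g] lifts to
    a child of the second coordinate. *)
Lemma pullback_light1 : light_par (fun x : rt_V pullback => (tval x).1).
Proof.
case: hf hg => fr fnr fp fl [gr gnr gp gl]; split.
- by rewrite tval_root.
- move=> x; rewrite tval_eq_root; apply: contra => /eqP/(pb_root1 (tvalP x)).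
  by move=> ->.
- by move=> x; rewrite tval_par.
move=> x b nb pb; have /eqP xok := tvalP x.
have [c pc gc] : exists2 c, par c = (tval x).2 & g c = f b.
  by apply: gl; rewrite ?fnr // -fp pb.
have hok : ok (b, c) by rewrite /ok gc.
exists (tmk pb_ok_root pb_ok_par pb_par_root pb_par_lt hok); last by rewrite tvalK.
by apply: tval_inj; rewrite tval_par tvalK /p /= pb pc; case: (tval x).
Qed.

Lemma pullback_light2 : light_par (fun x : rt_V pullback => (tval x).2).
Proof.
case: hf hg => fr fnr fp fl [gr gnr gp gl]; split.
- by rewrite tval_root.
- move=> x; rewrite tval_eq_root; apply: contra => /eqP e.
  have /eqP xok := tvalP x; apply/eqP/(pb_root1 (tvalP x))/eqP.
  by rewrite -(light_par_eq_root hf) xok e gr.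
- by move=> x; rewrite tval_par.
move=> x c nc pc; have /eqP xok := tvalP x.
have [b pb fb] : exists2 b, par b = (tval x).1 & f b = g c.
  by apply: fl; rewrite ?gnr // -gp pc.
have hok : ok (b, c) by rewrite /ok fb.
exists (tmk pb_ok_root pb_ok_par pb_par_root pb_par_lt hok); last by rewrite tvalK.
by apply: tval_inj; rewrite tval_par tvalK /p /= pb pc; case: (tval x).
Qed.

Lemma pullback_comm (x : rt_V pullback) : f (tval x).1 = g (tval x).2.
Proof. by apply/eqP; apply: (tvalP x). Qed.

End Pullback.

(** * Tiling *)

Definition map_class := forall S T : rtree, (rt_V S -> rt_V T) -> Prop.

Inductive comp_closure (X : map_class) : map_class :=
| comp_closure_in S T (f : rt_V S -> rt_V T) : X S T f -> comp_closure X f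
| comp_closure_comp S U T (f : rt_V U -> rt_V T) (g : rt_V S -> rt_V U)
    (h : rt_V S -> rt_V T) :
    comp_closure X f -> comp_closure X g -> (forall x, h x = f (g x)) ->
    comp_closure X h.

(* In the square, [P'] is the class of the map opposite to [f], and [Q'] that of
   the map opposite to [g]. *)
Definition amalgamates (P Q P' Q' : map_class) : Prop :=
  forall A B C (f : rt_V B -> rt_V A) (g : rt_V C -> rt_V A), P B A f -> Q C A g ->
  exists D (f0 : rt_V D -> rt_V B) (g0 : rt_V D -> rt_V C),
    [/\ Q' D B f0, P' D C g0 & forall x, f (f0 x) = g (g0 x)].

Lemma amalgamates_sym P Q P' Q' : amalgamates P Q P' Q' -> amalgamates Q P Q' P'.
Proof.
move=> h A B C f g hf hg; have [D [f0 [g0 [h1 h2 e]]]] := h _ _ _ g f hg hf.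
by exists D, g0, f0; split=> // x; rewrite e.
Qed.

(** Squares are placed side by side: the map opposite to [f] in one square is again in [P] and
    serves as the side of the next. *)
Lemma amalgamates_closure P Q : amalgamates P Q P (comp_closure Q) ->
  amalgamates P (comp_closure Q) P (comp_closure Q).
Proof.
move=> h A B C f g hf hg; elim: hg B f hf => {A C g} [C A g hg|C U A g1 g2 g _ IH1 _ IH2 ge] B f hf.
  exact: h hf hg.
have [D1 [f1 [h1 [hf1 hh1 e1]]]] := IH1 _ _ hf.
have [D2 [f2 [h2 [hf2 hh2 e2]]]] := IH2 _ _ hh1.
exists D2, (f1 \o f2), h2; split=> //; first exact: comp_closure_comp hf1 hf2 _.
by move=> x; rewrite ge -e2 -e1.
Qed.

(** Composites are allowed first on one side, then, by symmetry, on the other: a strip of squares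
    becomes a grid. *)
Lemma amalgamates_closure2 P : amalgamates P P P P ->
  amalgamates (comp_closure P) (comp_closure P) (comp_closure P) (comp_closure P).
Proof.
move=> h.
have h1 : amalgamates P (comp_closure P) P (comp_closure P).
  apply: amalgamates_closure => A B C f g hf hg.
  have [D [f0 [g0 [h1 h2 e]]]] := h _ _ _ f g hf hg.
  by exists D, f0, g0; split=> //; exact: comp_closure_in.
have h2 : amalgamates (comp_closure P) P (comp_closure P) (comp_closure P).
  move=> A B C f g hf hg; have [D [f0 [g0 [h2 h3 e]]]] := amalgamates_sym h1 hf hg.
  by exists D, f0, g0; split=> //; exact: comp_closure_in.
exact: amalgamates_closure h2.
Qed.

(** Isomorphisms are included because they arise opposite to a splitting when both splittings
    coincide. *)
Definition split_step : map_class := fun S T f =>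
  tree_iso f \/ exists x c, splits f x c.

Definition simple_monotone : map_class := comp_closure split_step.

Definition light_or_monotone : map_class := fun S T f =>
  light_par f \/ simple_monotone f.

Lemma split_step_iso (S U T : rtree) (f : rt_V U -> rt_V T) (g : rt_V S -> rt_V U) :
  tree_iso f -> split_step g -> split_step (f \o g).
Proof.
move=> fi [gi|[x [c gs]]]; first by left; apply: tree_iso_comp.
by right; exists x, c; apply: splits_iso.
Qed.

Lemma split_step_retr (T : rtree) (P : {set rt_V T * bool}) q : q.1 != rt_root T ->
  split_step (@sd_retr T (q |: P) P).
Proof.
move=> nq; case: (boolP (q \in P)) => [qP|qP]; last by right; apply: sd_retr_splits.
left; have -> : q |: P = P by apply/setUidPr; rewrite sub1set.
have [[h hK hK'] h1 h2] := tree_iso_id (subdivide P).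
split; first by exists id => x; rewrite sd_retr_id.
  by rewrite sd_retr_id.
by move=> x; rewrite !sd_retr_id.
Qed.

(** The new vertices are forgotten one at a time. *)
Lemma sd_pi_monotone (T : rtree) (P : {set rt_V T * bool}) :
  (forall q, q \in P -> q.1 != rt_root T) -> simple_monotone (@sd_pi T P).
Proof.
have [n] := ubnP #|P|; elim: n P => // n IH P hn nP.
case: (set_0Vmem P) => [->|[q qP]].
  by apply: comp_closure_in; left; apply: sd_pi0_iso.
have := hn; rewrite (cardsD1 q) qP add1n ltnS => {}hn.
have mP : simple_monotone (@sd_pi T (P :\ q)).
  by apply: IH => // q'; rewrite !inE => /andP[_]; exact: nP.
have := split_step_retr (P :\ q) (nP _ qP); rewrite setD1K // => hr.
apply: comp_closure_comp mP (comp_closure_in hr) _ => x.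
by rewrite sd_pi_retr.
Qed.

(** The amalgam of two splittings is the subdivision at both points. These may lie in different
    halves of one edge; if they are equal, the retractions are isomorphisms. *)
Lemma amalgamates_split_split :
  amalgamates split_step split_step split_step split_step.
Proof.
have iso_case A B C (f : rt_V B -> rt_V A) (g : rt_V C -> rt_V A) :
    tree_iso f -> split_step g ->
    exists D (f0 : rt_V D -> rt_V B) (g0 : rt_V D -> rt_V C),
    [/\ split_step f0, split_step g0 & forall x, f (f0 x) = g (g0 x)].
  move=> /tree_iso_inv[f' [fi fK f'K]] hg; exists C, (f' \o g), id.
  split; [exact: split_step_iso|left; exact: tree_iso_id|by move=> x /=; rewrite f'K].
move=> A B C f g [fi|[x [c fs]]] hg; first exact: iso_case.
case: (hg) => [gi|[y [d gs]]].
  have [|D [g0 [f0 [h1 h2 e]]]] := iso_case _ _ _ g f gi; first by right; exists x, c.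
  by exists D, f0, g0; split=> // v; rewrite e.
have [p [hp [np ip fp]]] := splits_subdivide fs.
have [q [hq [nq iq gq]]] := splits_subdivide gs.
exists (subdivide [set p; q]), (hp \o @sd_retr _ _ _), (hq \o @sd_retr _ _ _); split.
- by apply: split_step_iso ip _; rewrite setUC; apply: split_step_retr.
- by apply: split_step_iso iq _; apply: split_step_retr.
by move=> v /=; rewrite fp gq !sd_pi_retr.
Qed.

(** With the splitting written as a subdivision of [A] at [q], the amalgam is the subdivision of [B]
    at all points over [q]. *)
Lemma amalgamates_light_split :
  amalgamates light_par split_step light_par simple_monotone.
Proof.
move=> A B C f g hf [/tree_iso_inv[g' [gi gK g'K]]|[y [d /splits_subdivide[q [h [nq hi hg]]]]]].
  exists B, id, (g' \o f); split=> [||x /=]; last by rewrite g'K.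
    by apply: comp_closure_in; left; apply: tree_iso_id.
  by apply: light_par_comp hf; apply: tree_iso_light_par.
exists (subdivide (sd_preim f [set q])), (@sd_pi _ _), (h \o sd_map (P := [set q]) hf); split.
- apply: sd_pi_monotone => p; rewrite !inE => /eqP e.
  by rewrite -(light_par_eq_root hf) -[f p.1]/((f p.1, p.2).1) e.
- by apply: light_par_comp (sd_map_light _ hf); apply: tree_iso_light_par.
by move=> x /=; rewrite hg sd_pi_map.
Qed.

Lemma amalgamates_generators :
  amalgamates light_or_monotone light_or_monotone light_or_monotone light_or_monotone.
Proof.
have MM := amalgamates_closure2 amalgamates_split_split.
have LM := amalgamates_closure amalgamates_light_split.
have ML := amalgamates_sym LM.
move=> A B C f g [hf|hf] [hg|hg].
- exists (pullback hf hg), (fun x => (tval x).1), (fun x => (tval x).2); split.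
  + by left; apply: pullback_light1.
  + by left; apply: pullback_light2.
  + exact: pullback_comm.
- by have [D [f0 [g0 [h1 h2 e]]]] := LM _ _ _ _ _ hf hg; exists D, f0, g0; split; [right|left|].
- by have [D [f0 [g0 [h1 h2 e]]]] := ML _ _ _ _ _ hf hg; exists D, f0, g0; split; [left|right|].
- by have [D [f0 [g0 [h1 h2 e]]]] := MM _ _ _ _ _ hf hg; exists D, f0, g0; split; [right|right|].
Qed.

Lemma splits_simple_confluent (S T : rtree) (f : rt_V S -> rt_V T) x c :
  splits f x c -> simple_confluent f.
Proof. by move/splits_splitting; apply: sc_split. Qed.

Lemma light_par_simple_confluent (S T : rtree) (f : rt_V S -> rt_V T) :
  light_par f -> simple_confluent f.
Proof. by move/light_par_light_confluent; apply: sc_light. Qed.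

(** The isomorphisms added to the splittings bring in nothing new, being light confluent
    themselves. *)
Lemma simple_confluent_closure (S T : rtree) (f : rt_V S -> rt_V T) :
  simple_confluent f <-> comp_closure light_or_monotone f.
Proof.
split.
  elim=> {S T f} [S T f /light_confluent_par hf|S T f /splitting_splits[x [c hf]]|].
  - by apply: comp_closure_in; left.
  - by apply/comp_closure_in; right; apply/comp_closure_in; right; exists x, c.
  by move=> S U T f g h _ hf _ hg; apply: comp_closure_comp.
elim=> {S T f} [S T f [/light_par_simple_confluent //|]|S U T f g h _ hf _ hg]; last exact: sc_comp.
elim=> {S T f}
  [S T f [/tree_iso_light_par/light_par_simple_confluent //|[x [c]]]|S U T f g h _ hf _ hg].
  exact: splits_simple_confluent.
exact: sc_comp.
Qed.

Lemma amalgamates_simple_confluent :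
  amalgamates simple_confluent simple_confluent simple_confluent simple_confluent.
Proof.
move=> A B C f g /simple_confluent_closure hf /simple_confluent_closure hg.
have [D [f0 [g0 [h1 h2 e]]]] := amalgamates_closure2 amalgamates_generators hf hg.
by exists D, f0, g0; split=> //; apply/simple_confluent_closure.
Qed.

Lemma epi_comp (S U T : rtree) (f : rt_V U -> rt_V T) (g : rt_V S -> rt_V U)
    (h : rt_V S -> rt_V T) :
  epi f -> epi g -> (forall x, h x = f (g x)) -> epi h.
Proof.
case=> f1 f2 f3 f4 f5 [g1 g2 g3 g4 g5] e; split.
- by move=> x y xy; rewrite !e; apply/f1/g1.
- by move=> v; have [u <-] := f2 v; have [x <-] := g2 u; exists x; rewrite e.
- move=> u v /f3[a [b [ab <- <-]]]; have [x [y [xy <- <-]]] := g3 _ _ ab.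
  by exists x, y; rewrite !e.
- by rewrite e g4 f4.
by move=> x y xy; rewrite !e; apply/f5/g5.
Qed.

Lemma simple_confluent_epi (S T : rtree) (f : rt_V S -> rt_V T) :
  simple_confluent f -> epi f.
Proof.
elim=> {S T f} [S T f [] //|S T f /splitting_splits[x [c]]|S U T f g h _ hf _ hg].
  exact: splits_epi.
exact: epi_comp.
Qed.

Lemma simple_confluent_id (T : rtree) : simple_confluent (fun x : rt_V T => x).
Proof. exact/light_par_simple_confluent/tree_iso_light_par/tree_iso_id. Qed.

(** * Joint projection and countability *)

Section RemoveVertex.
Variables (T : rtree) (x : rt_V T).
Hypothesis nx : x != rt_root T.

Let ok : pred (rt_V T) := fun v => v != x.
Let p v := if par v == x then par x else par v.

Fact rm_ok_root : ok (rt_root T).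
Proof. by rewrite /ok eq_sym. Qed.

Fact rm_ok_par v : ok v -> ok (p v).
Proof. by move=> _; rewrite /ok /p; case: ifP => [_|->//]; rewrite par_neq. Qed.

Fact rm_par_root : p (rt_root T) = rt_root T.
Proof. by rewrite /p par_root eq_sym (negPf nx). Qed.

Fact rm_par_lt v : ok v -> v != rt_root T -> ht (p v) < ht v.
Proof.
move=> _ nv; rewrite /p; case: eqP => [e|_]; last exact: ht_par_lt.
by rewrite (ht_par nv) e ltnS; apply/ltnW/ht_par_lt.
Qed.

Definition remove_vertex := restricted_tree rm_ok_root rm_ok_par rm_par_root rm_par_lt.

Definition rm_mk v (h : v != x) : rt_V remove_vertex :=
  tmk rm_ok_root rm_ok_par rm_par_root rm_par_lt h.

Lemma card_remove_vertex : #|rt_V remove_vertex| < #|rt_V T|.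
Proof.
rewrite card_sig; apply: (@leq_ltn_trans #|predC1 x|).
  by apply/subset_leq_card/subsetP.
by rewrite cardC1 ltn_predL; apply/card_gt0P; exists x.
Qed.

Section Retract.
Variable u : rt_V T.
Hypothesis nu : u != x.

Fact rm_retract_ok v : (if v == x then u else v) != x.
Proof. by case: ifP => // ->. Qed.

Definition rm_retract v : rt_V remove_vertex := rm_mk (rm_retract_ok v).

Lemma rm_retractE v : tval (rm_retract v) = if v == x then u else v.
Proof. exact: tvalK. Qed.

(** Folds the leaf [x] onto [u]. As [u] has no children, there is nothing to lift at [x]. *)
Lemma rm_retract_sibling_leaf : u != rt_root T -> par u = par x ->
  (forall v, v != rt_root T -> par v != x) -> (forall v, v != rt_root T -> par v != u) ->
  light_par rm_retract.
Proof.
move=> nur pu xleaf uleaf.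
have npx v : par v != x.
  by case: (eqVneq v (rt_root T)) => [->|/xleaf //]; rewrite par_root eq_sym.
have retr_id v : v != x -> tval (rm_retract v) = v by rewrite rm_retractE => /negPf ->.
split.
- by apply: tval_inj; rewrite retr_id // eq_sym.
- by move=> v nv; rewrite tval_eq_root rm_retractE; case: ifP.
- move=> v; apply: tval_inj; rewrite retr_id // tval_par rm_retractE /p.
  by rewrite (negPf (npx _)); case: eqP => [->|].
move=> v w nw /(congr1 (@tval _ _ _ _ _ _ _ _ _)).
rewrite tval_par rm_retractE /p (negPf (npx _)) => e; have wx : tval w != x := tvalP w.
exists (tval w); last by apply: tval_inj; rewrite retr_id.
rewrite tval_eq_root in nw; move: e; case: (eqVneq v x) => // _ e.
by have := uleaf _ nw; rewrite e eqxx.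
Qed.
End Retract.

Lemma rm_retract_only_child c (npx : par x != x) : par c = x ->
  (forall v, par v = x -> v = c) -> splits (rm_retract npx) x c.
Proof.
move=> pc conly.
have retr_id v : v != x -> tval (rm_retract npx v) = v by rewrite rm_retractE => /negPf ->.
have ncx : c != x by apply/eqP => e; move: (npx); rewrite -{1}e pc eqxx.
split=> //.
- by apply: tval_inj; rewrite retr_id // eq_sym.
- by move=> v w nv nw /(congr1 (@tval _ _ _ _ _ _ _ _ _)); rewrite !retr_id.
- move=> w; have wx : tval w != x := tvalP w; exists (tval w) => //.
  by apply: tval_inj; rewrite retr_id.
- move=> v nv nvc; have npv : par v != x by apply: contra nvc => /eqP/conly ->.
  by apply: tval_inj; rewrite tval_par !retr_id // /p (negPf npv).
- by apply: tval_inj; rewrite tval_par !retr_id // /p pc eqxx.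
by right; apply: tval_inj; rewrite !rm_retractE eqxx; case: ifP.
Qed.

End RemoveVertex.

Fact edge_par_lt (b : bool) : b != false -> nat_of_bool false < b.
Proof. by case: b. Qed.

Definition edge_tree : rtree :=
  @parent_tree bool (fun _ => false) false nat_of_bool erefl edge_par_lt.

Lemma edge_par (b : rt_V edge_tree) : par b = (false : bool).
Proof. exact: (@par_unique edge_tree (fun _ => false) nat_of_bool erefl edge_par_lt). Qed.

Lemma nontrivial_root (T : rtree) :
  2 <= #|rt_V T| <-> exists v, v != rt_root T.
Proof.
split=> [/card_gt1P[u [v [_ _ uv]]]|[v nv]].
  case: (eqVneq u (rt_root T)) => [e|]; last by exists u.
  by exists v; rewrite -e eq_sym.
by apply/card_gt1P; exists v, (rt_root T).
Qed.

Lemma simple_confluent_edge (T : rtree) : (exists v, v != rt_root T) ->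
  exists f : rt_V T -> rt_V edge_tree, simple_confluent f.
Proof.
have [n] := ubnP #|rt_V T|; elim: n T => // n IH T hn [v0 nv0].
(* The surviving vertex [w] keeps the smaller tree nontrivial, so the induction hypothesis applies
   to it. *)
have step x (nx : x != rt_root T) (g : rt_V T -> rt_V (remove_vertex nx)) w :
    simple_confluent g -> w != x -> w != rt_root T ->
    exists f : rt_V T -> rt_V edge_tree, simple_confluent f.
  move=> hg nw nw'; have [||f hf] := IH (remove_vertex nx).
  - exact: leq_trans (card_remove_vertex nx) hn.
  - by exists (rm_mk nx nw); rewrite tval_eq_root.
  by exists (f \o g); apply: sc_comp hf hg _.
have [y _ ymax] := arg_maxnP (P := predT) (@ht T) (erefl : predT (rt_root T)).
have leaf z : ht z = ht y -> forall v, v != rt_root T -> par v != z.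
  move=> hz v nv; apply/eqP => e; have := ymax v isT.
  by rewrite /= (ht_par nv) e hz ltnn.
have ny : y != rt_root T.
  apply/eqP => e; have := ymax v0 isT.
  by rewrite e (ht_par nv0) ht_root.
case: (pickP (fun z => [&& z != y, z != rt_root T & par z == par y])) => [z|onlyy].
  case/and3P => nzy nz /eqP pz.
  apply: (step y ny (rm_retract ny nzy) z) => //.
  apply: light_par_simple_confluent; apply: rm_retract_sibling_leaf => //; apply: leaf => //.
  by rewrite (ht_par nz) pz -ht_par.
have only v : v != rt_root T -> par v = par y -> v = y.
  move=> nv pv; apply/eqP; apply: contraFT (onlyy v) => nvy.
  by rewrite nvy nv pv eqxx.
(* Here [y] is the only child of its parent. If that parent is not the root, it is contracted
   upwards; otherwise the tree is already a single edge. *)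
case: (eqVneq (par y) (rt_root T)) => [py|npy]; last first.
  have ne := par_neq npy.
  apply: (step _ npy (rm_retract npy ne) y) => //; last by rewrite eq_sym par_neq.
  apply: (@splits_simple_confluent _ _ _ (par y) y).
  apply: rm_retract_only_child => // v pv.
  apply: (only _ _ pv); apply: contraNneq npy => e.
  by rewrite -pv e par_root.
(* The deepest vertex [y] has height one, so every vertex other than the root is a child of the
   root. *)
have all_v v : v != rt_root T -> v = y.
  move=> nv; apply: only => //; rewrite py; apply/eqP.
  have := ymax v isT; rewrite /= (ht_par nv) (ht_par ny) py ht_root ltnS leqn0.
  by apply: contraLR => /ht_par ->.
exists (fun v => v != rt_root T : bool).
apply/light_par_simple_confluent/tree_iso_light_par; split.
- exists (fun b : bool => if b then y else rt_root T).
    by move=> v; case: eqVneq => //= /all_v.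
  by case; rewrite ?ny ?eqxx.
- by rewrite eqxx.
move=> v; rewrite edge_par; case: (eqVneq v (rt_root T)) => [->|/all_v ->].
  by rewrite par_root eqxx.
by rewrite py eqxx.
Qed.

(** * Countability, by adjacency matrices *)

Definition tree_code (T : rtree) : seq (seq bool) * nat :=
  ([seq [seq rt_adj x y | y <- enum (rt_V T)] | x <- enum (rt_V T)],
   index (rt_root T) (enum (rt_V T))).

Lemma tree_code_iso (S T : rtree) : tree_code S = tree_code T -> rt_iso S T.
Proof.
case=> eadj eroot.
have esize : size (enum (rt_V S)) = size (enum (rt_V T)).
  by have := congr1 size eadj; rewrite !size_map.
pose tr (X Y : rtree) (x : rt_V X) := nth (rt_root Y) (enum (rt_V Y)) (index x (enum (rt_V X))).
have trK X Y : size (enum (rt_V X)) = size (enum (rt_V Y)) -> cancel (tr X Y) (tr Y X).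
  move=> e x; rewrite /tr index_uniq ?enum_uniq ?nth_index ?mem_enum //.
  by rewrite -e index_mem mem_enum.
have adjE X (a b : rt_V X) : rt_adj a b =
    nth false (nth [::] (tree_code X).1 (index a (enum (rt_V X)))) (index b (enum (rt_V X))).
  rewrite /= (nth_map a) ?index_mem ?mem_enum // (nth_map a) ?index_mem ?mem_enum //.
  by rewrite !nth_index ?mem_enum.
have trI x : index (tr S T x) (enum (rt_V T)) = index x (enum (rt_V S)).
  by rewrite index_uniq ?enum_uniq // -esize index_mem mem_enum.
exists (tr S T); split.
- by exists (tr T S); apply: trK.
- by move=> x y; rewrite !adjE !trI /= eadj.
by rewrite /tr eroot nth_index ?mem_enum.
Qed.

(** For each number a tree with that code is chosen, or [edge_tree] if there is none; trees with
    equal codes are isomorphic. *)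
Lemma countably_many_trees : exists e : nat -> rtree, forall T, exists n, rt_iso (e n) T.
Proof.
have dec n : {T | (exists S, pickle (tree_code S) = n) -> pickle (tree_code T) = n}.
  case: (excluded_middle_informative (exists S, pickle (tree_code S) = n)) => [h|h].
    by case: (constructive_indefinite_description _ h) => T eT; exists T.
  by exists edge_tree => /h.
exists (fun n => sval (dec n)) => T; exists (pickle (tree_code T)).
apply: tree_code_iso; apply: (pcan_inj pickleK).
by apply: (svalP (dec _)); exists T.
Qed.

(** Keeps amalgams inside the family: a vertex over a non-root vertex is not the root. *)
Lemma simple_confluent_nontrivial (S T : rtree) (f : rt_V S -> rt_V T) :
  simple_confluent f -> 2 <= #|rt_V T| -> 2 <= #|rt_V S|.
Proof.
case/simple_confluent_epi => _ fsurj _ froot _ /nontrivial_root[v nv].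
apply/nontrivial_root; have [x fx] := fsurj v; exists x.
by apply: contraNneq nv => e; rewrite -fx e froot.
Qed.

Theorem theorem8p7 :
  proj_fraisse_family (fun T : rtree => 2 <= #|rt_V T|) simple_confluent.
Proof.
split.
- by have [e he] := countably_many_trees; exists e => T _; apply: he.
- by move=> S T f _ _; apply: simple_confluent_epi.
- split=> [S U T f g _ _ _ hf hg|T _]; first exact: sc_comp hf hg _.
  exact: simple_confluent_id.
- move=> A B hA hB.
  have [f hf] := simple_confluent_edge (proj1 (nontrivial_root A) hA).
  have [g hg] := simple_confluent_edge (proj1 (nontrivial_root B) hB).
  have [D [f0 [g0 [h1 h2 _]]]] := amalgamates_simple_confluent hf hg.
  by exists D, f0, g0; split=> //; apply: simple_confluent_nontrivial h1 hA.
move=> A B C f g _ hB _ hf hg.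
have [D [f0 [g0 [h1 h2 e]]]] := amalgamates_simple_confluent hf hg.
by exists D, f0, g0; split=> //; apply: simple_confluent_nontrivial h1 hB.
Qed.
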